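(* Let $\mathcal U_1,\mathcal U_2\subset\mathbb R^n$ be connected open sets and $W\in C^\infty(\mathcal U_1\times\mathcal U_2)$. Let $\gamma: T^*\mathcal U_1\to T^*\mathcal U_2$ be a canonical transformation with generating function $W$, that is, for all $(x,\xi)\in T^*\mathcal U_1$ and $(y,\eta)\in T^*\mathcal U_2$, $$(y,\eta)=\gamma(x,\xi)\iff \xi=-\frac{\partial W}{\partial x}(x,y)\ \text{ and }\ \eta=\frac{\partial W}{\partial y}(x,y).$$ Let $F\in C^\infty(\mathcal U_1)$, let $\Lambda_1=\{(x,\xi)\in T^*\mathcal U_1: \xi=\frac{\partial F}{\partial x}(x)\}$ and $\Lambda_2=\gamma(\Lambda_1)$. Suppose that for every $y\in\mathcal U_2$ the function $$x\mapsto W(x,y)+F(x)$$ on $\mathcal U_1$ has a unique critical point, and that this critical point is a nondegenerate minimum. Then $\Lambda_2$ is a horizontal Lagrangian submanifold of $T^*\mathcal U_2$: one has $$\Lambda_2=\Bigl\{(y,\eta)\in T^*\mathcal U_2:\ \eta=\frac{\partial G}{\partial y}(y)\Bigr\},\qquad\text{where } G(y)=\min_{x\in\mathcal U_1}\bigl(F(x)+W(x,y)\bigr),\ \ G\in C^\infty(\mathcal U_2).$$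
   Context: Cotangent bundles carry their standard symplectic forms; points of $T^*\mathcal U_1$ are written $(x,\xi)$ and points of $T^*\mathcal U_2$ are written $(y,\eta)$. A canonical transformation $\gamma: T^*\mathcal U_1\to T^*\mathcal U_2$ is a diffeomorphism onto an open subset of $T^*\mathcal U_2$ that preserves the symplectic forms. A Lagrangian submanifold of $T^*\mathcal U$ is called horizontal if it is the graph $\{(y,\frac{\partial G}{\partial y}(y))\}$ of the differential of a smooth function $G$ on $\mathcal U$. *)

(* Defs.v *)
From HB Require Import structures.
From mathcomp Require Import all_boot all_order all_algebra.
From mathcomp Require Import all_classical all_reals all_analysis.

Set Implicit Arguments.
Unset Strict Implicit.
Unset Printing Implicit Defensive.

Import Order.TTheory GRing.Theory Num.Theory.
Import numFieldNormedType.Exports.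

Local Open Scope classical_set_scope.
Local Open Scope ring_scope.

(* C^k on U, for finite-dimensional V and open U: f is C^(k+1) iff it is
   (Frechet) differentiable on U and x |-> 'd f x v is C^k for every v. *)
Fixpoint Ck (R : realType) (V W : normedModType R) (k : nat) (U : set V)
    (f : V -> W) : Prop :=
  match k with
  | 0 => forall x, U x -> {for x, continuous f}
  | k'.+1 => (forall x, U x -> differentiable f x) /\
             (forall v : V, Ck k' U (fun x => 'd f x v))
  end.

Definition smooth_on (R : realType) (V W : normedModType R) (U : set V)
    (f : V -> W) : Prop :=
  forall k, Ck k U f.

Definition grad (R : realType) (n : nat) (f : 'rV[R]_n -> R) (x : 'rV[R]_n) :
    'rV[R]_n :=
  \row_i 'D_(delta_mx 0 i) f x.

Definition hessian (R : realType) (n : nat) (f : 'rV[R]_n -> R)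
    (x : 'rV[R]_n) : 'M[R]_n :=
  \matrix_(i, j) 'D_(delta_mx 0 i) ('D_(delta_mx 0 j) f) x.

Definition critical_point (R : realType) (n : nat) (U : set 'rV[R]_n)
    (f : 'rV[R]_n -> R) (x : 'rV[R]_n) : Prop :=
  U x /\ grad f x = 0.

Definition is_minimum (R : realType) (S : set R) (m : R) : Prop :=
  S m /\ lbound S m.

(* x is a minimum of f over all of U (not only a local one), and it is
   nondegenerate as a critical point. *)
Definition nondegenerate_minimum (R : realType) (n : nat) (U : set 'rV[R]_n)
    (f : 'rV[R]_n -> R) (x : 'rV[R]_n) : Prop :=
  [/\ U x, is_minimum (f @` U) (f x) & hessian f x \in unitmx].

(* Points (x, xi) of T^*R^n, and also tangent vectors to T^*R^n. *)
Definition phase_space (R : realType) (n : nat) : normedModType R :=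
  ('rV[R]_n * 'rV[R]_n)%type.

Definition cotangent (R : realType) (n : nat) (U : set 'rV[R]_n) :
    set (phase_space R n) :=
  [set p | U p.1].

(* \sum_i d(xi_i) /\ d(x_i) *)
Definition omega (R : realType) (n : nat) (u v : phase_space R n) : R :=
  \sum_i (u.2 0 i * v.1 0 i - u.1 0 i * v.2 0 i).

(* f, restricted to the open set A, is a diffeomorphism onto an open subset
   of B; the values of f outside A are irrelevant. *)
Definition diffeo_onto_open (R : realType) (V W : normedModType R) (A : set V)
    (B : set W) (f : V -> W) : Prop :=
  exists g : W -> V,
    [/\ f @` A `<=` B, open (f @` A), smooth_on A f, smooth_on (f @` A) g &
        forall x, A x -> g (f x) = x].

Definition canonical_transformation (R : realType) (n : nat)
    (U1 U2 : set 'rV[R]_n) (gamma : phase_space R n -> phase_space R n) :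
    Prop :=
  diffeo_onto_open (cotangent U1) (cotangent U2) gamma /\
  forall p, cotangent U1 p ->
    forall u v, omega ('d gamma p u) ('d gamma p v) = omega u v.

Definition generating_function (R : realType) (n : nat)
    (U1 U2 : set 'rV[R]_n) (gamma : phase_space R n -> phase_space R n)
    (W : 'rV[R]_n * 'rV[R]_n -> R) : Prop :=
  forall x xi y eta : 'rV[R]_n, U1 x -> U2 y ->
    (y, eta) = gamma (x, xi) <->
    xi = - grad (fun x' => W (x', y)) x /\ eta = grad (fun y' => W (x, y')) y.

Definition grad_graph (R : realType) (n : nat) (U : set 'rV[R]_n)
    (G : 'rV[R]_n -> R) : set (phase_space R n) :=
  [set p | cotangent U p /\ p.2 = grad G p.1].

(* Velocities at p of smooth curves in L through p. *)
Definition tangent_vector (R : realType) (n : nat) (L : set (phase_space R n))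
    (p v : phase_space R n) : Prop :=
  exists (e : R) (c : R -> phase_space R n),
    [/\ 0 < e, smooth_on (ball (0 : R) e) c,
        forall t, ball (0 : R) e t -> L (c t), c 0 = p & 'D_1 c 0 = v].

(* Embedded n-dimensional submanifold of the 2n-dimensional phase space, given
   by slice charts Phi straightening L to R^n x {0}. *)
Definition half_dim_submanifold (R : realType) (n : nat)
    (M L : set (phase_space R n)) : Prop :=
  L `<=` M /\
  forall p, L p ->
    exists (O : set (phase_space R n)) (Phi : phase_space R n -> phase_space R n),
      [/\ open O, O p, O `<=` M, diffeo_onto_open O setT Phi &
          forall q, O q -> L q <-> (Phi q).2 = 0].

Definition lagrangian_submanifold (R : realType) (n : nat)
    (M L : set (phase_space R n)) : Prop :=
  half_dim_submanifold M L /\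
  forall p, L p ->
    forall u v, tangent_vector L p u -> tangent_vector L p v -> omega u v = 0.

Definition horizontal_lagrangian (R : realType) (n : nat) (U : set 'rV[R]_n)
    (L : set (phase_space R n)) : Prop :=
  lagrangian_submanifold (cotangent U) L /\
  exists G : 'rV[R]_n -> R, smooth_on U G /\ L = grad_graph U G.

(* Main.v *)
(* Write f(x, y) = W(x, y) + F(x) and let x(y) be the minimizer of f(., y).
   The points of Lambda2 over y come from the critical points of f(., y), so
   they are the single point (y, dW/dy(x(y), y)), and the envelope theorem
   identifies its second component with dG/dy for G(y) = f(x(y), y).
   Smoothness of x(y): on a small sphere around x(y0) the function f(., y0)
   exceeds f(x(y0), y0), and by compactness this persists for y near y0, so
   f(., y) has an interior minimum in the ball, which by uniqueness is x(y);
   hence x is continuous. A continuous solution of df/dx(x(y), y) = 0 with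
   invertible Hessian is differentiable, with derivative given by the
   implicit function formula, and smoothness follows by bootstrapping that
   formula. Finally the graph of dG is straightened by the shear (y, eta) |->
   (y, eta - dG(y)), and it is isotropic by the symmetry of second
   derivatives. *)
Require Import Defs.
From HB Require Import structures.
From mathcomp Require Import all_boot all_order all_algebra.
From mathcomp Require Import all_classical all_reals all_analysis.
From mathcomp Require Import ring lra.
Import Order.TTheory GRing.Theory Num.Theory.
Import numFieldNormedType.Exports.
Local Open Scope classical_set_scope.
Local Open Scope ring_scope.

Set Implicit Arguments.
Unset Strict Implicit.
Unset Printing Implicit Defensive.

(** * Differentials as estimates near a point, and the product rule *)

Section Differentials.
Context {R : realType}.
Implicit Types V W X : normedModType R.

Lemma diff_near V W (f : V -> W) (x : V) : differentiable f x ->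
  forall e, 0 < e ->
  \forall y \near x, `|f y - f x - 'd f x (y - x)| <= e * `|y - x|.
Proof.
move=> df e e0; have /diffE h := df.
near=> y.
rewrite {1}h lim_id // -addrA -opprD addrAC subrr add0r.
by near: y; apply: littleoP.
Unshelve. all: by end_near. Qed.

(** Converse of [diff_near]: the estimates say that [L] is a first-order expansion of [f], and
    uniqueness of such an expansion identifies [L] with the differential. *)
Lemma is_diff_near V W (f : V -> W) (L : {linear V -> W}) (x : V) :
  continuous L ->
  (forall e, 0 < e ->
    \forall y \near x, `|f y - f x - L (y - x)| <= e * `|y - x|) ->
  is_diff x f L.
Proof.
move=> cL h.
have E : f \o shift x = cst (f x) + L +o_ 0 id.
  apply/eqaddoP => e e0; rewrite [\forall y \near _, _ <= _](near_shift x).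
  rewrite sub0r; near=> y => /=.
  have -> : (f \o +%R^~ x - (cst (f x) + L)) (y - x) = f y - f x - L (y - x).
    transitivity (f (y - x + x) - (f x + L (y - x))) => //.
    by rewrite subrK opprD addrA.
  by near: y; exact: h.
have D : 'd f x = L :> (V -> W) by apply: diff_unique.
by apply: DiffDef => //; apply/diff_locallyP; rewrite D.
Unshelve. all: by end_near. Qed.

Lemma near_eq_is_diff V W (f g : V -> W) (x : V) :
  (\forall y \near x, f y = g y) -> differentiable f x ->
  is_diff x g ('d f x).
Proof.
move=> fg df; apply: is_diff_near; first exact: diff_continuous.
move=> e e0; near=> y.
rewrite -(near fg y) // -(nbhs_singleton fg).
by near: y; exact: diff_near.
Unshelve. all: by end_near. Qed.

(** Scaling under a name of its own, so that a bilinear structure can be attached to it. *)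
Let scale2 X : R -> X -> X := *:%R.

Let scale2_bilinear X : bilinear_for
    (GRing.Scale.Law.clone _ _ *:%R _) (GRing.Scale.Law.clone _ _ *:%R _)
    (@scale2 X).
Proof.
split=> [u'|u] a x y /=; rewrite /scale2.
- by rewrite scalerDl scalerA.
- by rewrite scalerDr !scalerA mulrC.
Qed.

(** The chain rule for the pair of [f] and [g] followed by scaling, a continuous bilinear map whose
    differential is known. *)
Lemma is_diff_scale V X (f : V -> R) (g : V -> X) (x : V) :
  differentiable f x -> differentiable g x ->
  is_diff x (fun y => f y *: g y)
    (fun h => f x *: 'd g x h + 'd f x h *: g x).
Proof.
move=> df dg.
pose bM :=
  bilinear_isBilinear.Build R R X X _ _ (@scale2 X) (@scale2_bilinear X).
pose b : {bilinear R -> X -> X} := HB.pack (@scale2 X) bM.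
have bc : continuous (fun p : R * X => b p.1 p.2) by exact: scale_continuous.
have Db p :
    is_diff p (fun p : R * X => b p.1 p.2) (fun q => b p.1 q.2 + b q.1 p.2).
  by apply: DiffDef; [exact: differentiable_bilin | exact: diff_bilin].
have Dp : is_diff x (fun y => (f y, g y)) (fun y => ('d f x y, 'd g x y)).
  by apply: is_diff_pair; apply: differentiableP.
exact: (is_diff_comp Dp (Db (f x, g x))).
Qed.

End Differentials.

(** * C^k functions: locality, sums, linear images and products *)

Section CkCalculus.
Context {R : realType}.
Implicit Types V W X Y : normedModType R.

Lemma eq_diff V (U : set V) W (f g : V -> W) : open U ->
  (forall x, U x -> f x = g x) -> forall x, U x -> differentiable f x ->
  is_diff x g ('d f x).
Proof.
move=> oU fg x Ux; apply: near_eq_is_diff.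
by have := open_nbhs_nbhs (conj oU Ux); apply: filterS => y /fg.
Qed.

(** On an open set, agreement of two functions passes to their differentials, which carries the
    induction. The closure properties below rely on this, since their formulas for differentials
    hold on [U] only. *)
Lemma eq_Ck k V (U : set V) W (f g : V -> W) : open U ->
  (forall x, U x -> f x = g x) -> Ck k U f -> Ck k U g.
Proof.
move=> oU; elim: k f g => [|k IH] f g fg /=.
  move=> cf x Ux. suff: g @ x --> g x by [].
  rewrite -(fg _ Ux).
  apply: cvg_trans (cf x Ux); apply: near_eq_cvg.
  by have := open_nbhs_nbhs (conj oU Ux); apply: filterS => y /fg.
move=> [df ddf]; split=> [x Ux|v].
  by have [] := eq_diff oU fg Ux (df _ Ux).
apply: IH (ddf v) => x Ux.
by have [_ ->] := eq_diff oU fg Ux (df _ Ux).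
Qed.

Lemma Ck_pred k V (U : set V) W (f : V -> W) : Ck k.+1 U f -> Ck k U f.
Proof.
elim: k f => [|k IH] f /= [df ddf].
  by move=> x /df; exact: differentiable_continuous.
by split=> // v; apply: IH; exact: ddf.
Qed.

Lemma Ck_cst k V (U : set V) W (a : W) : Ck k U (cst a).
Proof.
elim: k a => [|k IH] a /=; first by move=> x _; exact: cst_continuous.
split=> [x _|v]; first exact: differentiable_cst.
have -> : (fun x => 'd (cst a) x v) = cst 0 :> (V -> W).
  by apply/funext => x; rewrite diff_cst.
exact: IH.
Qed.

Lemma Ck_linear k V (U : set V) W (L : {linear V -> W}) :
  continuous L -> Ck k U L.
Proof.
case: k => [|k] cL /=; first by move=> x _; exact: cL.
split=> [x _|v]; first exact: linear_differentiable.
have -> : (fun x => 'd L x v) = cst (L v).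
  by apply/funext => x; rewrite diff_lin.
exact: Ck_cst.
Qed.

Lemma CkD k V (U : set V) W (f g : V -> W) : open U ->
  Ck k U f -> Ck k U g -> Ck k U (fun x => f x + g x).
Proof.
move=> oU; elim: k f g => [|k IH] f g /=.
  by move=> cf cg x Ux; apply: continuousD; [exact: cf|exact: cg].
move=> [df ddf] [dg ddg]; split=> [x Ux|v].
  by apply: (@differentiableD _ _ _ f g); [exact: df|exact: dg].
apply: (eq_Ck _ _ (IH _ _ (ddf v) (ddg v))) => // x Ux.
by rewrite (@diffD _ _ _ f g) //; [exact: df|exact: dg].
Qed.

Lemma Ck_sum k V (U : set V) W (I : Type) (r : seq I) (P : pred I)
    (f : I -> V -> W) :
  open U -> (forall i, P i -> Ck k U (f i)) ->
  Ck k U (fun x => \sum_(i <- r | P i) f i x).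
Proof.
move=> oU fP; elim: r => [|i r IH].
  by apply: eq_Ck (Ck_cst k U 0) => // x _; rewrite big_nil.
case: (boolP (P i)) => [Pi|nPi]; last first.
  by apply: eq_Ck IH => // x _; rewrite big_cons (negPf nPi).
by apply: eq_Ck (CkD oU (fP i Pi) IH) => // x _; rewrite big_cons Pi.
Qed.

Lemma Ck_lcomp k V (U : set V) W X (L : {linear W -> X}) (f : V -> W) :
  open U -> continuous L -> Ck k U f -> Ck k U (fun x => L (f x)).
Proof.
move=> oU cL; elim: k f => [|k IH] f /=.
  by move=> cf x Ux; apply: continuous_comp; [exact: cf|exact: cL].
move=> [df ddf]; split=> [x Ux|v].
  by apply: differentiable_comp; [exact: df|exact: linear_differentiable].
apply: (eq_Ck _ _ (IH _ (ddf v))) => // x Ux.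
rewrite (@diff_comp _ _ _ _ f L) /= ?diff_lin //; first exact: df.
exact: linear_differentiable.
Qed.

(** The product rule keeps one factor undifferentiated, so the induction step also uses that C^(k+1)
    implies C^k. *)
Lemma Ck_scale k V (U : set V) W (f : V -> R) (g : V -> W) : open U ->
  Ck k U f -> Ck k U g -> Ck k U (fun x => f x *: g x).
Proof.
move=> oU; elim: k f g => [|k IH] f g.
  by move=> cf cg x Ux; apply: continuousZ; [exact: cf|exact: cg].
move=> Cf Cg; have [df ddf] := Cf; have [dg ddg] := Cg; split=> [x Ux|v].
  by have [] := is_diff_scale (df _ Ux) (dg _ Ux).
have C := CkD oU (IH _ _ (Ck_pred Cf) (ddg v)) (IH _ _ (ddf v) (Ck_pred Cg)).
apply: eq_Ck C => // x Ux.
by have [_ ->] := is_diff_scale (df _ Ux) (dg _ Ux).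
Qed.

End CkCalculus.

(** * C^k functions: reciprocals, matrix inverses, coordinates and composition *)

Section CkFiniteDimensional.
Context {R : realType}.
Implicit Types V W X Y : normedModType R.

Lemma CkM k V (U : set V) (f g : V -> R) : open U ->
  Ck k U f -> Ck k U g -> Ck k U (fun x => f x * g x).
Proof. exact: Ck_scale. Qed.

Lemma CkN k V (U : set V) W (f : V -> W) : open U ->
  Ck k U f -> Ck k U (fun x => - f x).
Proof.
move=> oU Cf; apply: eq_Ck (Ck_scale oU (Ck_cst k U (-1 : R)) Cf) => // x _.
by rewrite scaleN1r.
Qed.

(** The derivative - f' / f^2 involves the reciprocal only at the order already reached, so the
    induction closes. *)
Lemma CkV k V (U : set V) (f : V -> R) : open U ->
  (forall x, U x -> f x != 0) -> Ck k U f -> Ck k U (fun x => (f x)^-1).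
Proof.
move=> oU f0; elim: k => [|k IH] Cf.
  by move=> x Ux; apply: continuousV; [exact: f0|exact: Cf].
have Cfk := IH (Ck_pred Cf); have [df ddf] := Cf; split=> [x Ux|v].
  by apply: differentiableV; [exact: df|exact: f0].
apply: eq_Ck (CkN oU (CkM oU (CkM oU Cfk Cfk) (ddf v))) => // x Ux.
rewrite diffV; [|exact: df|exact: f0].
by rewrite /= expr2 invfM -mulNr.
Qed.

Lemma Ck_prod k V (U : set V) (I : Type) (r : seq I) (P : pred I)
    (f : I -> V -> R) : open U -> (forall i, P i -> Ck k U (f i)) ->
  Ck k U (fun x => \prod_(i <- r | P i) f i x).
Proof.
move=> oU fP; elim: r => [|i r IH].
  by apply: eq_Ck (Ck_cst k U (1 : R)) => // x _; rewrite big_nil.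
case: (boolP (P i)) => [Pi|nPi]; last first.
  by apply: eq_Ck IH => // x _; rewrite big_cons (negPf nPi).
by apply: eq_Ck (CkM oU (fP i Pi) IH) => // x _; rewrite big_cons Pi.
Qed.

Lemma Ck_det k V (U : set V) n (M : V -> 'M[R]_n) : open U ->
  (forall i j, Ck k U (fun x => M x i j)) -> Ck k U (fun x => \det (M x)).
Proof.
move=> oU CM; apply: Ck_sum => // s _; apply: CkM => //; first exact: Ck_cst.
by apply: Ck_prod => // i _; exact: CM.
Qed.

(** By Cramer's rule each entry is a cofactor divided by the determinant, both polynomial in the
    entries of [M]. *)
Lemma Ck_invmx k V (U : set V) n (M : V -> 'M[R]_n) : open U ->
  (forall x, U x -> M x \in unitmx) ->
  (forall i j, Ck k U (fun x => M x i j)) ->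
  forall i j, Ck k U (fun x => invmx (M x) i j).
Proof.
move=> oU uM CM i j.
have Cdet : Ck k U (fun x => (\det (M x))^-1).
  apply: CkV (Ck_det oU CM) => // x Ux.
  by have := uM x Ux; rewrite unitmxE unitfE.
have Ccof : Ck k U (fun x => cofactor (M x) j i).
  apply: CkM => //; first exact: Ck_cst.
  apply: Ck_det => // i' j'.
  by apply: eq_Ck (CM (lift j i') (lift i j')) => // x _; rewrite !mxE.
apply: eq_Ck (CkM oU Cdet Ccof) => // x Ux.
by rewrite /invmx (uM _ Ux) !mxE.
Qed.

Lemma Ck_pair k V (U : set V) W X (f : V -> W) (g : V -> X) : open U ->
  Ck k U f -> Ck k U g -> Ck k U (fun x => (f x, g x)).
Proof.
move=> oU; elim: k f g => [|k IH] f g.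
  by move=> cf cg x Ux; apply: cvg_pair; [exact: cf|exact: cg].
move=> [df ddf] [dg ddg]; split=> [x Ux|v].
  by apply: differentiable_pair; [exact: df|exact: dg].
apply: eq_Ck (IH _ _ (ddf v) (ddg v)) => // x Ux.
by rewrite diff_pair //; [exact: df|exact: dg].
Qed.

Lemma fst_continuous V W : continuous (fst : V * W -> V).
Proof. by move=> x; exact: cvg_fst. Qed.

Lemma snd_continuous V W : continuous (snd : V * W -> W).
Proof. by move=> x; exact: cvg_snd. Qed.

Lemma Ck_fst k V W (U : set (V * W)) : Ck k U fst.
Proof. by apply: Ck_linear; exact: fst_continuous. Qed.

Lemma Ck_snd k V W (U : set (V * W)) : Ck k U snd.
Proof. by apply: Ck_linear; exact: snd_continuous. Qed.

(** Entry evaluation under a name, so that it can carry a linear structure. *)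
Definition mxcoord m n (i : 'I_m) (j : 'I_n) (M : 'M[R]_(m, n)) : R := M i j.

Let mxcoord_linear m n (i : 'I_m) (j : 'I_n) : linear (mxcoord i j).
Proof. by move=> a M N; rewrite /mxcoord !mxE. Qed.

HB.instance Definition _ m n (i : 'I_m) (j : 'I_n) :=
  GRing.isLinear.Build _ _ _ _ (mxcoord i j) (mxcoord_linear i j).

Lemma continuous_mxcoord m n (i : 'I_m) (j : 'I_n) :
  continuous (mxcoord i j : 'M[R]_(m, n) -> R).
Proof. exact: coord_continuous. Qed.

Lemma Ck_coord k V (U : set V) n (f : V -> 'rV[R]_n) i : open U ->
  Ck k U f -> Ck k U (fun x => f x 0 i).
Proof. by move=> oU; exact: (Ck_lcomp oU (@continuous_mxcoord _ _ 0 i)). Qed.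

Lemma Ck_rV k V (U : set V) n (f : V -> 'rV[R]_n) : open U ->
  (forall i, Ck k U (fun x => f x 0 i)) -> Ck k U f.
Proof.
move=> oU Cf.
suff C : Ck k U (fun x => \sum_i f x 0 i *: (delta_mx 0 i : 'rV[R]_n)).
  by apply: eq_Ck C => // x _; rewrite -row_sum_delta.
by apply: Ck_sum => // i _; apply: Ck_scale => //; exact: Ck_cst.
Qed.

(** Finite dimension, encoded by continuous linear coordinates and the vectors they recombine; this
    form passes directly to products. *)
Definition finite_coordinates W := exists (I : finType)
  (c : I -> {linear W -> R}) (e : I -> W),
  (forall i, continuous (c i)) /\ forall w, w = \sum_i c i w *: e i.

Lemma finite_coordinates_rV n : finite_coordinates 'rV[R]_n.
Proof.
exists 'I_n, (fun i => mxcoord 0 i), (fun i => delta_mx 0 i); split=> [i|w].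
  exact: continuous_mxcoord.
exact: row_sum_delta.
Qed.

Lemma finite_coordinates_pair V W : finite_coordinates V ->
  finite_coordinates W -> finite_coordinates (V * W)%type.
Proof.
move=> [I [c [e [cc ce]]]] [J [d [g [cd dg]]]].
exists (I + J)%type, (fun s => match s with
    | inl i => c i \o fst : {linear (V * W)%type -> R}
    | inr j => d j \o snd : {linear (V * W)%type -> R} end),
  (fun s => match s with inl i => (e i, 0) | inr j => (0, g j) end).
split=> [[i|j]|[v w]].
- move=> x; apply: continuous_comp; [exact: cvg_fst|exact: cc].
- move=> x; apply: continuous_comp; [exact: cvg_snd|exact: cd].
rewrite big_sumType /=.
have -> : \sum_i c i v *: (e i, 0 : W) = (v, 0).
  rewrite [in RHS](ce v).
  elim/big_rec2: _ => // i y1 y2 _ ->.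
  by congr (_, _); rewrite /= scaler0 addr0.
have -> : \sum_i d i w *: (0 : V, g i) = (0, w).
  rewrite [in RHS](dg w).
  elim/big_rec2: _ => // i y1 y2 _ ->.
  by congr (_, _); rewrite /= scaler0 addr0.
by congr (_, _); rewrite /= ?addr0 ?add0r.
Qed.

(* Finite dimension of [W] is what makes C^k-ness of all directional
   derivatives stable under composition: it turns [x |-> 'd g (f x) ('d f x v)]
   into a finite sum of products. *)
Lemma Ck_comp k V W X (U : set V) (U' : set W) (f : V -> W) (g : W -> X) :
  finite_coordinates W -> open U -> (forall x, U x -> U' (f x)) ->
  Ck k U f -> Ck k U' g -> Ck k U (g \o f).
Proof.
move=> [I [c [e [cc ce]]]] oU fU; elim: k f g fU => [|k IH] f g fU.
  by move=> Cf Cg x Ux; apply: continuous_comp; [exact: Cf|exact/Cg/fU].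
move=> Cf Cg; have [df ddf] := Cf; have [dg ddg] := Cg; split=> [x Ux|v].
  by apply: differentiable_comp; [exact: df|exact/dg/fU].
have C : Ck k U (fun x => \sum_i c i ('d f x v) *: 'd g (f x) (e i)).
  apply: Ck_sum => // i _; apply: Ck_scale => //.
    exact: (Ck_lcomp oU (cc i) (ddf v)).
  exact: (IH f (fun y => 'd g y (e i)) fU (Ck_pred Cf) (ddg (e i))).
apply: eq_Ck C => // x Ux.
rewrite (@diff_comp _ _ _ _ f g) /=; [|exact: df|exact/dg/fU].
rewrite [in RHS](ce ('d f x v)) linear_sum.
by apply: eq_bigr => i _; rewrite linearZ.
Qed.

End CkFiniteDimensional.

(** * Restriction to lines and the first-order condition at a minimum *)

Section LocalCalculus.
Context {R : realType}.
Implicit Types V W X : normedModType R.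

Lemma is_diff_line V W (f : V -> W) (a c : V) (s : R) :
  differentiable f (s *: a + c) ->
  is_diff s (fun t => f (t *: a + c)) (fun h => 'd f (s *: a + c) (h *: a)).
Proof.
move=> df.
have Da : is_diff s (fun t : R => t *: a + c) (fun h => h *: a).
  have -> : (fun h : R => h *: a) = *:%R^~ a + 0 by rewrite addr0.
  have D1 := is_diff_scalel s a.
  have D2 : is_diff s (cst c : R -> V) 0 by exact: is_diff_cst.
  exact: (is_diffD D1 D2).
exact: (is_diff_comp Da (differentiableP df)).
Qed.

Lemma is_derive_line V W (f : V -> W) (a c : V) (s : R) :
  differentiable f (s *: a + c) ->
  is_derive s 1 (fun t => f (t *: a + c)) ('d f (s *: a + c) a).
Proof.
move=> /is_diff_line[ds dE]; apply: DeriveDef; first exact: diff_derivable.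
by rewrite deriveE // dE scale1r.
Qed.

(** Moving a little along [v] cannot decrease [f], so the differential is nonnegative at [v]; the
    same at [- v] forces it to vanish. *)
Lemma local_min_diff V (f : V -> R) (x : V) : differentiable f x ->
  (\forall y \near x, f x <= f y) -> forall v, 'd f x v = 0.
Proof.
move=> df fmin.
suff H v : 0 <= 'd f x v.
  by move=> v; apply/eqP; rewrite eq_le H andbT -oppr_ge0 -linearN H.
rewrite leNgt; apply/negP => d0.
have v0 : 0 < `|v| + 1 by rewrite ltr_wpDl.
have e0 : 0 < - 'd f x v / (`|v| + 1) by rewrite divr_gt0 // oppr_gt0.
have cx : (fun t : R => t *: v + x) @ 0^'+ --> x.
  have : (fun t : R => t *: v + x) @ 0 --> 0 *: v + x.
    by apply: cvgD; [apply: cvgZr_tmp; exact: cvg_id|exact: cvg_cst].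
  by rewrite scale0r add0r; exact: cvg_at_right_filter.
have FG : \forall t \near 0^'+, f x <= f (t *: v + x) /\
    `|f (t *: v + x) - f x - 'd f x (t *: v + x - x)|
      <= - 'd f x v / (`|v| + 1) * `|t *: v + x - x|.
  exact: cx (filterI fmin (diff_near df e0)).
have [t [[Ft Gt] t0]] := filter_ex (filterI FG (nbhs_right_gt 0)).
move: Gt; rewrite addrK linearZ /= normrZ gtr0_norm // => /ler_normlW.
rewrite lerBlDr => Gt.
have : 0 <= - 'd f x v / (`|v| + 1) * (t * `|v|) + t * 'd f x v.
  by apply: le_trans Gt; rewrite subr_ge0.
apply/negP; rewrite -ltNge.
rewrite [ltLHS](_ : _ = t * 'd f x v / (`|v| + 1)).
  by rewrite pmulr_llt0 ?invr_gt0 // pmulr_rlt0.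
by field; rewrite gt_eqF.
Qed.

Lemma normr_pair_le V W (p : V * W) : `|p| <= `|p.1| + `|p.2|.
Proof. by rewrite prod_normE ge_max lerDl lerDr !normr_ge0. Qed.

Lemma continuous_pairl V W (v : V) : continuous (fun w : W => (v, w)).
Proof. by move=> w; apply: cvg_pair; [exact: cvg_cst|exact: cvg_id]. Qed.

Lemma continuous_pairr V W (w : W) : continuous (fun v : V => (v, w)).
Proof. by move=> v; apply: cvg_pair; [exact: cvg_id|exact: cvg_cst]. Qed.

End LocalCalculus.

(** * Symmetry of second derivatives *)

Section Schwarz.
Context {R : realType} {V : normedModType R}.

(* The mean value theorem on [s |-> f (s a + t b + x) - f (s a + x)] turns the
   second difference, which is symmetric in [a] and [b], into an increment of
   ['d f _ a], so mere differentiability of ['d f _ a] at [x] suffices. *)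
Let second_difference_near (f : V -> R) (U : set V) (x a b : V) (e : R) :
  open U -> U x -> (forall z, U z -> differentiable f z) ->
  differentiable (fun z => 'd f z a) x -> 0 < e ->
  \forall t \near 0^'+,
   `|f (t *: a + (t *: b + x)) - f (t *: a + x) - f (t *: b + x) + f x
     - t ^+ 2 * 'd (fun z => 'd f z a) x b| <= e * t ^+ 2.
Proof.
move=> oU Ux df dda e0.
set h := fun z => 'd f z a; set A := 'd h x.
pose c : R := `|a| + `|a| + `|b| + 1.
have c0 : 0 < c by rewrite ltr_wpDl // !addr_ge0.
have ec0 : 0 < e / c by rewrite divr_gt0.
have : \forall z \near x, U z /\ `|h z - h x - A (z - x)| <= e / c * `|z - x|.
  by near=> z; split; near: z; [exact: open_nbhs_nbhs|exact: diff_near].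
move=> /nbhs_ballP[d /= d0 dU].
near=> t.
have t0 : 0 < t by [].
have td : t * c < d.
  by rewrite -ltr_pdivlMr //; near: t; apply: nbhs_right_lt; rewrite divr_gt0.
have inb s (w : V) : 0 <= s <= t -> `|w| <= t * `|b| ->
    ball x d (s *: a + (w + x)).
  move=> /andP[s0 st] wb; rewrite -ball_normE /= distrC addrA addrK.
  apply: le_lt_trans td; apply: le_trans (ler_normD _ _) _.
  rewrite normrZ ger0_norm // /c.
  have : s * `|a| <= t * `|a| by rewrite ler_wpM2r.
  have : 0 <= t * `|a| by rewrite mulr_ge0 // ltW.
  nra.
have normtb : `|t *: b| <= t * `|b| by rewrite normrZ gtr0_norm.
have norm0 : `|0 : V| <= t * `|b| by rewrite normr0 mulr_ge0 // ltW.
have in0 s : 0 <= s <= t -> ball x d (s *: a + x).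
  by move=> st; rewrite -[x in X in ball _ _ X]add0r; exact: inb norm0.
pose phi := fun s => f (s *: a + (t *: b + x)) - f (s *: a + x).
have dphi s : 0 <= s <= t -> is_derive s 1 phi
    (h (s *: a + (t *: b + x)) - h (s *: a + x)).
  move=> st; apply: is_deriveB; apply: is_derive_line; apply: df.
    by have [] := dU _ (inb _ _ st normtb).
  by have [] := dU _ (in0 _ st).
have [s] : exists2 s, s \in `[0, t] & phi t - phi 0 =
    (h (s *: a + (t *: b + x)) - h (s *: a + x)) * (t - 0).
  apply: (MVT_segment (ltW t0)) => [s /[!in_itv]/= /andP[s0 st]|].
    by apply: dphi; rewrite !ltW.
  apply: derivable_within_continuous => s /[!in_itv]/= st.
  by have [] := dphi s st.
rewrite in_itv /= subr0 /phi !scale0r !add0r => st.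
have [_] := dU _ (inb _ _ st normtb).
have [_] := dU _ (in0 _ st).
rewrite addrK addrA addrK.
rewrite (linearD A) !(linearZZ A).
set H1 := h (s *: a + x); set H2 := h (_ + _ + x).
move=> E1 E2 E3.
have st' := andP st.
have na : `|s *: a| <= t * `|a|.
  by rewrite normrZ ger0_norm ?ler_wpM2r //; case: st'.
have nab : `|s *: a + t *: b| <= t * `|a| + t * `|b|.
  by apply: le_trans (ler_normD _ _) _; exact: lerD.
have {}E1 := le_trans E1 (ler_wpM2l (ltW ec0) na).
have {}E2 := le_trans E2 (ler_wpM2l (ltW ec0) nab).
(* The quantity is [t] times the difference of the first-order errors of [h] at the two points; the
   terms in [A a] cancel. *)
rewrite [X in `|X| <= _](_ : _ =
    t * ((H2 - h x - (s *: A a + t *: A b)) - (H1 - h x - s *: A a)));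
  last first.
  transitivity ((H2 - H1) * t - t ^+ 2 * A b).
    by rewrite -E3 opprB [in RHS]addrA [in RHS]addrAC.
  by rewrite -![_ *: (_ : R)]/(_ * _); ring.
rewrite normrM gtr0_norm // expr2 mulrCA ler_wpM2l ?(ltW t0) //.
apply: le_trans (ler_normB _ _) _.
apply: le_trans (lerD E2 E1) _.
rewrite -mulrDr.
have -> : e * t = e / c * (t * c) by field; rewrite gt_eqF.
rewrite ler_wpM2l ?(ltW ec0) // /c.
by move: (ltW t0); lra.
Unshelve. all: by end_near. Qed.

(** One second difference approximates both mixed derivatives times [t ^+ 2], each with error
    [e / 2 * t ^+ 2]; dividing by [t ^+ 2] leaves a gap of at most [e], for every positive [e]. *)
Lemma second_diffC (f : V -> R) (U : set V) (x a b : V) :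
  open U -> U x -> (forall z, U z -> differentiable f z) ->
  (forall v, differentiable (fun z => 'd f z v) x) ->
  'd (fun z => 'd f z a) x b = 'd (fun z => 'd f z b) x a.
Proof.
move=> oU Ux df ddf.
apply/eqP; rewrite -subr_eq0 -normr_le0; apply/ler_addgt0Pr => e e0.
rewrite add0r.
have e2 : 0 < e / 2 by rewrite divr_gt0.
have Ea := second_difference_near b oU Ux df (ddf a) e2.
have Eb := second_difference_near a oU Ux df (ddf b) e2.
have [t [[/= {}Ea {}Eb] t0]] :=
  filter_ex (filterI (filterI Ea Eb) (nbhs_right_gt 0)).
have t2 : 0 < t ^+ 2 by rewrite exprn_gt0.
rewrite -(ler_pM2l t2) -[X in X * `|_|](gtr0_norm t2) -normrM.
have := lerD Eb Ea.
set A := 'd _ x b; set B := 'd _ x a.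
rewrite -mulrDl -splitr [e * _]mulrC; apply: le_trans.
rewrite [t *: b + (t *: a + x)]addrCA.
apply: le_trans (ler_normB _ _); rewrite le_eqVlt; apply/orP; left; apply/eqP.
congr `|_|; ring.
Qed.

End Schwarz.

(** * Differentiability of implicit functions and continuity of minimizers *)

Section Implicit.
Context {R : realType}.
Implicit Types V W X : normedModType R.

(** [L] inverts the partial differential in the first variable on the left. Applied to the expansion
    of [Phi] along [(xs y, y)], where [Phi] vanishes, it isolates the increment of [xs]. Continuity
    of [xs] brings [(xs y, y)] into the range of that expansion. *)
Lemma is_diff_implicit V W X (Phi : V * W -> X) (xs : W -> V) (y0 : W)
    (L : {linear X -> V}) :
  differentiable Phi (xs y0, y0) -> {for y0, continuous xs} ->
  (\forall y \near y0, Phi (xs y, y) = 0) -> continuous L ->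
  (forall u, L ('d Phi (xs y0, y0) (u, 0)) = u) ->
  is_diff y0 xs (fun w => - L ('d Phi (xs y0, y0) (0, w))).
Proof.
move=> dPhi cxs Phi0 cL Linv.
set D := 'd Phi (xs y0, y0).
pose M w := - L (D (0, w)).
have Mlin : linear M.
  move=> k u v; rewrite /M scalerN -opprD.
  rewrite -linearZ -linearD -linearZ -linearD /=.
  by congr (- L (D (_, _))); rewrite /= scaler0 addr0.
pose MM := GRing.isLinear.Build _ _ _ _ M Mlin.
pose ML : {linear W -> V} := HB.pack M MM.
have cM : continuous ML.
  have c2 : continuous (fun w => D (0, w)).
    move=> w; apply: (@continuous_comp _ _ _ (fun w : W => (0 : V, w)) D).
      exact: continuous_pairl.
    exact: diff_continuous.
  have c3 : continuous (fun w => L (D (0, w))).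
    by move=> w; apply: (continuous_comp (c2 w)); exact: cL.
  by move=> w; exact: (continuousN (c3 w)).
apply: (@is_diff_near _ _ _ xs ML) => // e e0.
have [k k0 Lk] := linear_lipschitz cL.
have [b b0 Mb] := linear_lipschitz cM.
have LD u w : L (D (u, w)) = u - M w.
  have -> : (u, w) = (u, 0) + (0, w) by congr (_, _); rewrite /= ?addr0 ?add0r.
  by rewrite linearD linearD /= Linv /M opprK.
have cp : (fun y => (xs y, y)) @ y0 --> (xs y0, y0).
  by apply: cvg_pair; [exact: cxs|exact: cvg_id].
have est d : 0 < d -> \forall y \near y0,
    `|xs y - xs y0 - M (y - y0)| <= d * (`|xs y - xs y0| + `|y - y0|).
  move=> d0; have dk0 : 0 < d / k by rewrite divr_gt0.
  have E := cp _ (diff_near dPhi dk0).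
  near=> y.
  have Ey : `|Phi (xs y, y) - Phi (xs y0, y0) - D ((xs y, y) - (xs y0, y0))| <=
     d / k * `|(xs y, y) - (xs y0, y0)| by near: y.
  move: Ey; rewrite (nbhs_singleton Phi0).
  have -> : Phi (xs y, y) = 0 by near: y.
  rewrite subr0 sub0r normrN => Ey.
  rewrite -LD; apply: le_trans (Lk _) _.
  rewrite -ler_pdivlMl //.
  apply: le_trans Ey _.
  rewrite mulrA [k^-1 * d]mulrC ler_wpM2l ?(ltW dk0) //.
  exact: normr_pair_le.
(* By [E3] below, the increments of [xs] and [y] together are at most [2 * b + 2] times that of [y],
   where [b] is a Lipschitz constant of [M]. *)
have b2 : 0 < 2 * b + 2 by rewrite ltr_wpDl // mulr_ge0 // ltW.
have d2 : 0 < e / (2 * b + 2) by rewrite divr_gt0.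
near=> y.
(* Accuracy 1/2 lets the increment of [xs] on the right be absorbed on the left. This gives the
   linear bound [E3], which turns the finer estimate [E2] into a little-o of [y - y0]. *)
have E1 : `|xs y - xs y0 - M (y - y0)| <= 2^-1 * (`|xs y - xs y0| + `|y - y0|).
  by near: y; apply: est; rewrite invr_gt0.
have E2 : `|xs y - xs y0 - M (y - y0)| <=
    e / (2 * b + 2) * (`|xs y - xs y0| + `|y - y0|).
  by near: y; apply: est.
have E3 : `|xs y - xs y0| <= (2 * b + 1) * `|y - y0|.
  have : `|xs y - xs y0| <= `|xs y - xs y0 - M (y - y0)| + `|M (y - y0)|.
    by rewrite -[X in `|X| <= _](subrK (M (y - y0))); exact: ler_normD.
  have := Mb (y - y0); rewrite /=.
  set u := `|_ - _|; set w := `|y - y0|.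
  move: E1; rewrite -/u -/w; lra.
apply: le_trans E2 _.
have -> : e * `|y - y0| = e / (2 * b + 2) * ((2 * b + 2) * `|y - y0|).
  by field; rewrite gt_eqF.
rewrite ler_wpM2l ?(ltW d2) //.
move: E3; lra.
Unshelve. all: by end_near. Qed.

(** Uniqueness is required among local minimizers because the compactness argument on a small ball
    produces only a local one. *)
Lemma continuous_argmin n W (U1 : set 'rV[R]_n) (U2 : set W)
    (f : 'rV[R]_n * W -> R) (xs : W -> 'rV[R]_n) :
  open U1 -> open U2 -> Ck 0 (U1 `*` U2) f ->
  (forall y, U2 y -> U1 (xs y)) ->
  (forall x y, U1 x -> U2 y -> f (xs y, y) <= f (x, y)) ->
  (forall x y, U1 x -> U2 y ->
     (\forall x' \near x, f (x, y) <= f (x', y)) -> x = xs y) ->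
  forall y, U2 y -> {for y, continuous xs}.
Proof.
move=> oU1 oU2 cf xsU1 xs_min xs_uniq y0 U2y0.
set x0 := xs y0.
have U1x0 : U1 x0 by exact: xsU1.
(* A point doing as well as [x0] would also be a global minimizer of [f (_, y0)], hence a local one,
   hence [x0]. *)
have strict x : U1 x -> x != x0 -> f (x0, y0) < f (x, y0).
  move=> U1x; apply: contra_neqT; rewrite -leNgt => fx.
  apply: xs_uniq => //.
  have : nbhs x U1 by exact: open_nbhs_nbhs.
  by apply: filterS => x' U1x'; apply: le_trans fx _; exact: xs_min.
apply/cvgrPdist_lt => /= e e0.
have : nbhs x0 (U1 `&` ball x0 e).
  by apply: filterI; [exact: open_nbhs_nbhs|exact: nbhsx_ballx].
move=> /nbhs_closedballP[r rU].
have r0 : 0 < r%:num by [].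
pose K : set 'rV[R]_n := closed_ball x0 r%:num.
pose S : set 'rV[R]_n := K `&` [set x | `|x0 - x| = r%:num].
have KE : K = [set x | `|x0 - x| <= r%:num] by rewrite /K closed_ballE.
have cK : compact K.
  apply: bounded_closed_compact; last exact: closed_ball_closed.
  exists (`|x0| + r%:num); split; first exact: num_real.
  move=> M ltM x; rewrite KE /= => xr; apply: le_trans (ltW ltM).
  have -> : x = x0 - (x0 - x) by rewrite opprB addrC subrK.
  by apply: le_trans (ler_normB _ _) _; rewrite lerD2l.
have cS : compact S.
  apply: (subclosed_compact _ cK); last by move=> x [].
  apply: closedI; first exact: closed_ball_closed.
  have cn : continuous (fun x : 'rV[R]_n => `|x0 - x|).
    move=> x.
    apply: (@continuous_comp _ _ _ (fun x : 'rV[R]_n => x0 - x) Num.norm).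
      exact: (continuousB (@cst_continuous _ _ _ _)).
    exact: norm_continuous.
  apply: (preimage_closed _ (@closed_eq _ r%:num)) => x _; exact: cn.
(* Continuity gives the strict inequality near each [(x, y0)] with [x] on the sphere; compactness of
   the sphere makes it hold for all such [x] and a common neighbourhood of [y0]. *)
have near_S : \forall y \near y0, S `<=` [set x | f (x0, y) < f (x, y)].
  apply: (proj1 (compact_near_coveringP S) cS) => x [Kx xr].
  have /rU[U1x _] : closed_ball x0 r%:num x by [].
  have neq : x != x0.
    by apply: contraTneq r0 => xx0; rewrite -xr xx0 subrr normr0 ltxx.
  have cfx : {for (x, y0), continuous f} by exact: cf.
  have cf0 : {for (x, y0), continuous (fun p => f (x0, p.2))}.
    have c1 : {for y0, continuous (fun y => f (x0, y))}.
      apply: (@continuous_comp _ _ _ (fun y : W => (x0, y)) f); last exact: cf.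
      exact: continuous_pairl.
    exact: (continuous_comp (@snd_continuous _ _ _ (x, y0)) c1).
  have cg := continuousB cfx cf0.
  have pos : 0 < (f - (fun p => f (x0, p.2))) (x, y0).
    by rewrite subr_gt0; exact: strict.
  have G : \forall p \near (x, y0), f (x0, p.2) < f (p.1, p.2).
    near=> p; rewrite -surjective_pairing -subr_gt0.
    by near: p; exact: (cvgr_gt _ cg _ pos).
  exact: G.
have near_U2 : \forall y \near y0, U2 y by exact: open_nbhs_nbhs.
near=> y.
have U2y : U2 y by near: y.
have Sy : S `<=` [set x | f (x0, y) < f (x, y)] by near: y.
have K0 : K x0 by rewrite KE /= subrr normr0.
have cfy : {within K, continuous (fun x => f (x, y))}.
  apply: continuous_in_subspaceT => x /set_mem /rU[U1x _].
  apply: (@continuous_comp _ _ _ (fun x : 'rV[R]_n => (x, y)) f).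
    exact: continuous_pairr.
  exact: cf.
have [x1 /set_mem Kx1 x1min] : exists2 c, c \in K &
    forall t, t \in K -> f (c, y) <= f (t, y) :=
  EVT_min_rV (ex_intro _ _ K0) cK cfy.
(* A minimizer over the closed ball cannot lie on the sphere, where [f (_, y)] exceeds its value at
   the centre; being interior, it is a local minimizer. *)
have x1r : `|x0 - x1| < r%:num.
  rewrite lt_neqAle; apply/andP; split; last by have := Kx1; rewrite -/K KE.
  apply/eqP => x1S; have := Sy x1 (conj Kx1 x1S).
  by rewrite /= ltNge x1min // inE.
have [U1x1 x1e] := rU _ Kx1.
rewrite -(xs_uniq x1 y) //; last first.
  have : nbhs x1 (ball x0 r%:num).
    by apply: open_nbhs_nbhs; split; [exact: ball_open|rewrite -ball_normE].
  by apply: filterS => x' /subset_closed_ball Kx'; apply: x1min; rewrite inE.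
by move: x1e; rewrite -ball_normE.
Unshelve. all: by end_near. Qed.

End Implicit.

(** * Smoothness of implicit functions; slices and gradients *)

Section ImplicitSmooth.
Context {R : realType}.
Implicit Types V W X : normedModType R.

Lemma row_pairE n W (u : 'rV[R]_n) :
  (u, 0 : W) = \sum_i u 0 i *: (delta_mx 0 i : 'rV[R]_n, 0 : W).
Proof.
rewrite {1}(row_sum_delta u).
by elim/big_rec2: _ => // i y1 y2 _ <-; congr (_, _); rewrite /= scaler0 addr0.
Qed.

Lemma continuous_mulmxr n m (B : 'M[R]_(n, m)) :
  continuous (mulmxr B : 'rV[R]_n -> 'rV[R]_m).
Proof.
move=> u; suff C : Ck 0 setT (mulmxr B : 'rV[R]_n -> 'rV[R]_m) by exact: C.
apply: Ck_rV => [|i]; first exact: openT.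
have C : Ck 0 setT (fun u : 'rV[R]_n => \sum_j u 0 j * B j i).
  apply: Ck_sum => [|j _]; first exact: openT.
  apply: CkM; [exact: openT| |exact: Ck_cst].
  by move=> v _; exact: coord_continuous.
by apply: eq_Ck C => [|v _]; [exact: openT|rewrite mxE].
Qed.

(** Rows are indexed by the direction of differentiation, so the partial differential sends a row
    vector [u] to [u *m partial_jacobian Phi p]. *)
Definition partial_jacobian n W (Phi : 'rV[R]_n * W -> 'rV[R]_n) p : 'M[R]_n :=
  \matrix_(i, j) 'd Phi p (delta_mx 0 i, 0) 0 j.

(** The derivative of [xs] is an expression in matrix inverses and smooth functions evaluated at
    [(xs y, y)]. If [xs] is C^k, so is this expression, hence [xs] is C^(k+1). *)
Lemma smooth_implicit n W (U1 : set 'rV[R]_n) (U2 : set W)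
    (Phi : 'rV[R]_n * W -> 'rV[R]_n) (xs : W -> 'rV[R]_n) :
  finite_coordinates W -> open U1 -> open U2 ->
  smooth_on (U1 `*` U2) Phi ->
  (forall y, U2 y -> U1 (xs y)) ->
  (forall y, U2 y -> {for y, continuous xs}) ->
  (forall y, U2 y -> Phi (xs y, y) = 0) ->
  (forall y, U2 y -> partial_jacobian Phi (xs y, y) \in unitmx) ->
  smooth_on U2 xs.
Proof.
move=> fW oU1 oU2 sPhi xsU1 cxs Phi0 unitJ.
have graphU y : U2 y -> (U1 `*` U2) (xs y, y).
  by move=> U2y; split=> //=; exact: xsU1.
have dPhi y : U2 y -> differentiable Phi (xs y, y).
  by move=> U2y; have [d _] := sPhi 1; apply/d/graphU.
have dxs y : U2 y -> is_diff y xs (fun w => - mulmxr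
    (invmx (partial_jacobian Phi (xs y, y))) ('d Phi (xs y, y) (0, w))).
  move=> U2y; apply: is_diff_implicit; [exact: dPhi|exact: cxs| | |].
  - have : nbhs y U2 by exact: open_nbhs_nbhs.
    by apply: filterS => z /Phi0.
  - exact: continuous_mulmxr.
  - move=> u.
    have -> : 'd Phi (xs y, y) (u, 0) = u *m partial_jacobian Phi (xs y, y).
      rewrite row_pairE linear_sum; apply/rowP => j; rewrite !mxE summxE.
      by apply: eq_bigr => i _; rewrite linearZ !mxE.
    by rewrite /= mulmxK // unitJ.
elim=> [|k IH]; first exact: cxs.
split=> [y U2y|v]; first by have [] := dxs y U2y.
have fP : finite_coordinates ('rV[R]_n * W)%type.
  by apply: finite_coordinates_pair => //; exact: finite_coordinates_rV.
have Cgraph : Ck k U2 (fun y => (xs y, y)).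
  apply: Ck_pair => //.
  by apply: (@Ck_linear _ _ _ _ _ idfun) => y; exact: cvg_id.
have [_ ddPhi] := sPhi k.+1.
have Cd w : Ck k U2 (fun y => 'd Phi (xs y, y) w).
  exact: (Ck_comp fP oU2 graphU Cgraph (ddPhi w)).
apply: Ck_rV => // i.
have C : Ck k U2 (fun y => - \sum_j 'd Phi (xs y, y) (0, v) 0 j *
    invmx (partial_jacobian Phi (xs y, y)) j i).
  apply: CkN => //; apply: Ck_sum => // j _; apply: CkM => //.
    exact: Ck_coord.
  apply: Ck_invmx => // i' j'.
  have := Ck_coord j' oU2 (Cd (delta_mx 0 i', 0)).
  by apply: eq_Ck => // y _; rewrite mxE.
apply: eq_Ck C => // y U2y.
by have [_ ->] := dxs y U2y; rewrite !mxE.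
Qed.

Lemma is_diff_linear V W (L : {linear V -> W}) (x : V) :
  continuous L -> is_diff x L L.
Proof.
move=> cL; apply: DiffDef; first exact: linear_differentiable.
exact: diff_lin.
Qed.

Lemma is_diff_slice1 V W X (f : V * W -> X) (x : V) (y : W) :
  differentiable f (x, y) ->
  is_diff x (fun x' => f (x', y)) (fun v => 'd f (x, y) (v, 0)).
Proof.
move=> df.
have Dp := is_diff_pair (is_diff_id x) (is_diff_cst y x).
exact: (is_diff_comp Dp (differentiableP df)).
Qed.

Lemma is_diff_slice2 V W X (f : V * W -> X) (x : V) (y : W) :
  differentiable f (x, y) ->
  is_diff y (fun y' => f (x, y')) (fun w => 'd f (x, y) (0, w)).
Proof.
move=> df.
have Dp := is_diff_pair (is_diff_cst x y) (is_diff_id y).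
exact: (is_diff_comp Dp (differentiableP df)).
Qed.

Lemma grad_diff n (f : 'rV[R]_n -> R) x i : differentiable f x ->
  grad f x 0 i = 'd f x (delta_mx 0 i).
Proof. by move=> df; rewrite mxE deriveE. Qed.

Lemma smooth_grad n (U : set 'rV[R]_n) (f : 'rV[R]_n -> R) : open U ->
  smooth_on U f -> smooth_on U (grad f).
Proof.
move=> oU sf k; apply: Ck_rV => // i; have [df ddf] := sf k.+1.
apply: eq_Ck (ddf (delta_mx 0 i)) => // x Ux.
by rewrite grad_diff //; exact: df.
Qed.

End ImplicitSmooth.

(** * Graphs of differentials are Lagrangian *)

Section Lagrangian.
Context {R : realType} {n : nat}.

Lemma open_cotangent (U : set 'rV[R]_n) : open U -> open (cotangent U).
Proof.
move=> oU.
apply: (@open_comp _ _ (fst : 'rV[R]_n * 'rV[R]_n -> 'rV[R]_n)) => // p _.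
exact: cvg_fst.
Qed.

(** Schwarz puts the basis vector in the outer slot, where linearity allows summation against the
    components of a second vector. *)
Lemma diff_grad (U : set 'rV[R]_n) (G : 'rV[R]_n -> R) x w i : open U ->
  smooth_on U G -> U x ->
  'd (grad G) x w 0 i = 'd (fun z => 'd G z w) x (delta_mx 0 i).
Proof.
move=> oU sG Ux.
have [dG ddG] := sG 2.
have [dgrad _] := smooth_grad oU sG 1.
rewrite -(second_diffC _ _ oU Ux dG); last first.
  by move=> v; have [d _] := ddG v; exact: d.
have D := is_diff_comp (differentiableP (dgrad x Ux))
  (is_diff_linear (grad G x) (@continuous_mxcoord R 1 n 0 i)).
have E : is_diff x (fun z => 'd G z (delta_mx 0 i))
    ('d (mxcoord 0 i \o grad G) x).
  apply: (eq_diff oU _ Ux) => [z Uz|]; last by have [] := D.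
  by rewrite /= /mxcoord grad_diff //; exact: dG.
by have [_ ->] := E; have [_ ->] := D.
Qed.

(** Differentiate the relation [(c t).2 = grad G (c t).1] at time 0. *)
Lemma tangent_grad_graph (U : set 'rV[R]_n) (G : 'rV[R]_n -> R)
    (p v : 'rV[R]_n * 'rV[R]_n) : open U ->
  smooth_on U G -> tangent_vector (grad_graph U G) p v ->
  v.2 = 'd (grad G) (p.1) v.1.
Proof.
move=> oU sG [e [c [e0 sc cL c0 cv]]].
have [dc _] := sc 1.
have b0 : ball (0 : R) e 0 by exact: ballxx.
have dc0 := differentiableP (dc 0 b0).
have [Up _] := cL 0 b0.
have [dgrad _] := smooth_grad oU sG 1.
have D1 := is_diff_comp dc0 (is_diff_linear (c 0)
  (@fst_continuous R 'rV[R]_n 'rV[R]_n)).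
have D2 := is_diff_comp dc0 (is_diff_linear (c 0)
  (@snd_continuous R 'rV[R]_n 'rV[R]_n)).
have D3 := is_diff_comp D1 (differentiableP (dgrad _ Up)).
have E : is_diff 0 (snd \o c) ('d (grad G \o (fst \o c)) 0).
  apply: (@eq_diff _ _ (ball (0 : R) e)) => //; first exact: ball_open.
  by move=> t /cL[_ /= ->].
have [_ E2] := E; have [_ E3] := D3; have [_ E4] := D2.
rewrite -cv -c0 deriveE; last exact: dc.
exact: (congr1 (fun g : R -> 'rV[R]_n => g 1)
  (etrans (esym E4) (etrans E2 E3))).
Qed.

Lemma lagrangian_grad_graph (U : set 'rV[R]_n) (G : 'rV[R]_n -> R) : open U ->
  smooth_on U G -> lagrangian_submanifold (cotangent U) (grad_graph U G).
Proof.
move=> oU sG; have oC := open_cotangent oU.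
have sgrad1 k : Ck k (cotangent U) (fun p : phase_space R n => grad G p.1).
  have C1 : Ck k (cotangent U) (fst : 'rV[R]_n * 'rV[R]_n -> 'rV[R]_n).
    exact: Ck_fst.
  by apply: (@Ck_comp _ _ _ _ _ _ U _ _ (@finite_coordinates_rV R n) _ _ C1
    (smooth_grad oU sG k)).
split.
  split; first by move=> p [].
  move=> p [Up _].
  (* Shears fix the base point, so their parameters add: [shear (-1)] straightens the graph and
     [shear 1] is its smooth inverse. *)
  pose shear (s : R) (q : phase_space R n) : phase_space R n :=
    (q.1, q.2 + s *: grad G q.1).
  have sshear s : smooth_on (cotangent U) (shear s).
    move=> k; apply: (@Ck_pair _ _ _ _ _ _ fst) => //; first exact: Ck_fst.
    apply: (@CkD _ _ _ _ _ snd) => //; first exact: Ck_snd.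
    by apply: (@Ck_scale _ _ _ _ _ (cst s)) => //; exact: Ck_cst.
  have shearK s q : shear (- s) (shear s q) = q.
    by case: q => a b; rewrite /shear /= scaleNr addrK.
  have im : shear (-1) @` cotangent U = cotangent U.
    apply/seteqP; split=> [_ [q Uq <-] //|q Uq].
    by exists (shear 1 q) => //; exact: shearK.
  exists (cotangent U), (shear (-1)); split=> //.
    exists (shear 1); rewrite im; split=> // q _.
    by have := shearK (-1) q; rewrite opprK.
  move=> q Uq; rewrite /= scaleN1r.
  split=> [[_ ->]|/eqP]; first by rewrite subrr.
  by rewrite subr_eq0 => /eqP.
move=> p [Up _] u v tu tv.
rewrite /omega (tangent_grad_graph oU sG tu) (tangent_grad_graph oU sG tv).
(* Both sums in [omega] become second derivatives of [G] along the base components of [u] and [v],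
   in opposite orders, so Schwarz makes them cancel. *)
have E (a b : 'rV[R]_n) : \sum_i 'd (grad G) (p.1) a 0 i * b 0 i =
    'd (fun z => 'd G z a) (p.1) b.
  rewrite [in RHS](row_sum_delta b) linear_sum; apply: eq_bigr => i _.
  by rewrite linearZ (diff_grad _ _ oU sG Up) mulrC.
rewrite sumrB E.
under [X in _ - X]eq_bigr do rewrite mulrC.
rewrite E; apply/eqP; rewrite subr_eq0; apply/eqP.
have [dG ddG] := sG 2.
by apply: (second_diffC _ _ oU Up dG) => w; have [d _] := ddG w; exact: d.
Qed.

End Lagrangian.

Lemma open_setX (R : realType) (V W : normedModType R) (A : set V) (B : set W) :
  open A -> open B -> open (A `*` B).
Proof.
move=> oA oB; apply: openI.
  by apply: (@open_comp _ _ (fst : V * W -> V)) => // p _; exact: cvg_fst.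
by apply: (@open_comp _ _ (snd : V * W -> W)) => // p _; exact: cvg_snd.
Qed.

(** * Families of functions with a unique nondegenerate minimizer *)

Section CriticalFamily.
Context {R : realType} {n m : nat}.
Variables (U1 : set 'rV[R]_n) (U2 : set 'rV[R]_m).
Variables (f : 'rV[R]_n * 'rV[R]_m -> R) (xs : 'rV[R]_m -> 'rV[R]_n).
Hypotheses (oU1 : open U1) (oU2 : open U2) (sf : smooth_on (U1 `*` U2) f).

Let oU12 : open (U1 `*` U2).
Proof. exact: open_setX. Qed.

Let df p : (U1 `*` U2) p -> differentiable f p.
Proof. by have [d _] := sf 1; exact: d. Qed.

Let dfx x y : U1 x -> U2 y -> differentiable f (x, y).
Proof. by move=> U1x U2y; apply: df. Qed.

(** Built from the differential of [f] in both variables rather than from slices, so that it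
    inherits joint smoothness from [f]. *)
Definition partial_grad (p : 'rV[R]_n * 'rV[R]_m) : 'rV[R]_n :=
  \row_j 'd f p (delta_mx 0 j, 0).

Lemma grad_slice x y : U1 x -> U2 y ->
  grad (fun x' => f (x', y)) x = partial_grad (x, y).
Proof.
move=> U1x U2y; apply/rowP => j.
have [dslice E] := is_diff_slice1 (dfx U1x U2y).
by rewrite grad_diff // E mxE.
Qed.

Lemma smooth_partial_grad : smooth_on (U1 `*` U2) partial_grad.
Proof.
move=> k; apply: Ck_rV => // j; have [_ ddf] := sf k.+1.
by apply: eq_Ck (ddf (delta_mx 0 j, 0)) => // p _; rewrite mxE.
Qed.

(** The inner derivative of the slice equals a value of ['d f] throughout a neighbourhood of [x], so
    it may be replaced before the outer derivative is taken. *)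
Lemma hessian_slice x y : U1 x -> U2 y ->
  hessian (fun x' => f (x', y)) x = partial_jacobian partial_grad (x, y).
Proof.
move=> U1x U2y; apply/matrixP => i j; rewrite !mxE.
have [_ ddf] := sf 2.
have [dj _] := ddf (delta_mx 0 j, 0).
have dg := dj (x, y) (conj U1x U2y).
have [dpg _] := smooth_partial_grad 1.
have D := is_diff_comp (differentiableP (dpg (x, y) (conj U1x U2y)))
  (is_diff_linear (partial_grad (x, y)) (@continuous_mxcoord R 1 n 0 j)).
have E : is_diff (x, y) (fun p => 'd f p (delta_mx 0 j, 0))
    ('d (mxcoord 0 j \o partial_grad) (x, y)).
  apply: (eq_diff oU12) => [p _||]; [by rewrite /= /mxcoord mxE|by []|].
  by have [] := D.
have [ds ES] := is_diff_slice1 dg.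
rewrite (_ : 'D_(delta_mx 0 i) ('D_(delta_mx 0 j) (fun x' => f (x', y))) x
  = 'D_(delta_mx 0 i) (fun x' => 'd f (x', y) (delta_mx 0 j, 0)) x).
  rewrite deriveE // ES; have [_ ->] := E.
  by have [_ ->] := D.
apply: near_eq_derive.
have : nbhs x U1 by exact: open_nbhs_nbhs.
apply: filterS => z U1z.
have [dz Ez] := is_diff_slice1 (dfx U1z U2y).
by rewrite deriveE // Ez.
Qed.

Lemma diff_partial_grad0 x y u w : partial_grad (x, y) = 0 ->
  'd f (x, y) (u, w) = 'd f (x, y) (0, w).
Proof.
move=> g0; have -> : (u, w) = (u, 0) + (0, w).
  by congr (_, _); rewrite /= ?addr0 ?add0r.
rewrite linearD row_pairE linear_sum big1 ?add0r // => i _.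
rewrite linearZ; have /rowP/(_ i) := g0; rewrite !mxE => /= ->.
by rewrite scaler0.
Qed.

Hypotheses (xsU1 : forall y, U2 y -> U1 (xs y))
  (xs_min : forall x y, U1 x -> U2 y -> f (xs y, y) <= f (x, y))
  (xs_crit : forall y, U2 y -> partial_grad (xs y, y) = 0)
  (xs_uniq : forall x y, U1 x -> U2 y -> partial_grad (x, y) = 0 -> x = xs y)
  (xs_hess : forall y, U2 y ->
     partial_jacobian partial_grad (xs y, y) \in unitmx).

Lemma smooth_argmin : smooth_on U2 xs.
Proof.
apply: (smooth_implicit (@finite_coordinates_rV R m) oU1 oU2
  smooth_partial_grad) => //.
(* A local minimizer of a slice is critical by the first-order condition, so uniqueness of critical
   points applies. *)
apply: (continuous_argmin oU1 oU2 (sf 0)) => // x y U1x U2y xmin.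
apply: xs_uniq => //; apply/rowP => j; rewrite !mxE.
have [ds Es] := is_diff_slice1 (dfx U1x U2y).
by have := local_min_diff ds xmin (delta_mx 0 j); rewrite Es.
Qed.

Let graphU y : U2 y -> (U1 `*` U2) (xs y, y).
Proof. by move=> U2y; split => //=; exact: xsU1. Qed.

Lemma smooth_min_value : smooth_on U2 (fun y => f (xs y, y)).
Proof.
move=> k.
have Cgraph : Ck k U2 (fun y => (xs y, y)).
  apply: Ck_pair => //; first exact: smooth_argmin.
  by apply: (@Ck_linear _ _ _ _ _ idfun) => y; exact: cvg_id.
by apply: (Ck_comp _ oU2 graphU Cgraph (sf k));
  apply: finite_coordinates_pair; exact: finite_coordinates_rV.
Qed.

(* Envelope theorem: the derivative of the minimizer does not contribute. *)
Lemma grad_min_value y : U2 y ->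
  grad (fun y' => f (xs y', y')) y = grad (fun y' => f (xs y, y')) y.
Proof.
move=> U2y; have [dxs _] := smooth_argmin 1.
have dfy := df (graphU U2y).
have Dp := is_diff_pair (differentiableP (dxs y U2y)) (is_diff_id y).
have [d1 E1] := is_diff_comp Dp (differentiableP dfy).
have [d2 E2] := is_diff_slice2 dfy.
apply/rowP => i; rewrite grad_diff // grad_diff //.
rewrite [LHS](congr1 (fun g => g _) E1) E2 /=.
exact/diff_partial_grad0/xs_crit.
Qed.

End CriticalFamily.

(** * From the generating function to the graph of the differential of the minimum value *)

Unset Implicit Arguments.

Theorem theorem3p6 (R : realType) (n : nat) (U1 U2 : set 'rV[R]_n)
    (W : 'rV[R]_n * 'rV[R]_n -> R)
    (gamma : phase_space R n -> phase_space R n)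
    (F : 'rV[R]_n -> R)
    (openU1 : open U1) (connU1 : connected U1)
    (openU2 : open U2) (connU2 : connected U2)
    (smoothW : smooth_on (U1 `*` U2) W)
    (gammaC : canonical_transformation U1 U2 gamma)
    (gammaW : generating_function U1 U2 gamma W)
    (smoothF : smooth_on U1 F)
    (critWF : forall y, U2 y ->
       exists x, unique (critical_point U1 (fun x' => W (x', y) + F x')) x /\
                 nondegenerate_minimum U1 (fun x' => W (x', y) + F x') x) :
  let Lambda2 := gamma @` (grad_graph U1 F) in
  horizontal_lagrangian U2 Lambda2 /\
  exists G : 'rV[R]_n -> R,
    [/\ forall y, U2 y -> is_minimum [set F x + W (x, y) | x in U1] (G y),
        smooth_on U2 G &
        Lambda2 = grad_graph U2 G].
Proof.
pose f (p : 'rV[R]_n * 'rV[R]_n) := W p + F p.1.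
have sf : smooth_on (U1 `*` U2) f.
  move=> k; have oU12 := open_setX openU1 openU2.
  apply: CkD => //.
  apply: (@Ck_comp _ _ _ _ _ (U1 `*` U2) U1 fst F
    (@finite_coordinates_rV R n)) => //.
  - by move=> p [].
  - exact: Ck_fst.
have [xs xsP] : {xs : 'rV[R]_n -> 'rV[R]_n & forall y, U2 y ->
    unique (critical_point U1 (fun x' => f (x', y))) (xs y) /\
    nondegenerate_minimum U1 (fun x' => f (x', y)) (xs y)}.
  apply: (choice (P := fun y x => U2 y ->
    unique (critical_point U1 (fun x' => f (x', y))) x /\
    nondegenerate_minimum U1 (fun x' => f (x', y)) x)) => y.
  have [/critWF[x Hx]|nU2y] := pselect (U2 y); first by exists x.
  (* Off [U2] the required property is vacuous, and 0 is a default value. *)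
  by exists 0.
have xsU1 y : U2 y -> U1 (xs y) by move=> /xsP[_ []].
have xs_min x y : U1 x -> U2 y -> f (xs y, y) <= f (x, y).
  by move=> U1x /xsP[_ [_ [_ lb] _]]; apply: lb; exists x.
have xs_crit y : U2 y -> partial_grad f (xs y, y) = 0.
  move=> U2y; rewrite -(grad_slice sf (xsU1 y U2y) U2y).
  by have [[[_ ?] _] _] := xsP y U2y.
have xs_uniq x y : U1 x -> U2 y -> partial_grad f (x, y) = 0 -> x = xs y.
  move=> U1x U2y g0; have [[_ u] _] := xsP y U2y; apply/esym/u; split=> //.
  by rewrite (grad_slice sf).
have xs_hess y : U2 y -> partial_jacobian (partial_grad f) (xs y, y) \in unitmx.
  move=> U2y; rewrite -(hessian_slice openU1 openU2 sf (xsU1 y U2y) U2y).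
  by have [_ []] := xsP y U2y.
pose G y := f (xs y, y).
have sG : smooth_on U2 G.
  exact: (smooth_min_value openU1 openU2 sf xsU1 xs_min xs_crit xs_uniq
    xs_hess).
have [dW _] := smoothW 1; have [dF _] := smoothF 1.
(* After the envelope theorem [xs y] is frozen, so the contribution of [F] is constant in [y']. *)
have gradG y : U2 y -> grad G y = grad (fun y' => W (xs y, y')) y.
  move=> U2y; rewrite (grad_min_value openU1 openU2 sf xsU1 xs_min xs_crit
    xs_uniq xs_hess U2y).
  have [dy _] := is_diff_slice2 (dW (xs y, y) (conj (xsU1 y U2y) U2y)).
  apply/rowP => i; rewrite !mxE /f /=.
  rewrite (@deriveD _ _ _ (fun y' => W (xs y, y')) (cst (F (xs y)))) //.
    by rewrite derive_cst addr0.
  exact: diff_derivable.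
(* Criticality of [x] is exactly the first equation of the generating function for the covector
   [grad F x], that is, for the point of the first Lagrangian over [x]. *)
have critE x y : U1 x -> U2 y ->
    partial_grad f (x, y) = 0 <-> grad F x = - grad (fun x' => W (x', y)) x.
  move=> U1x U2y; rewrite -(grad_slice sf U1x U2y).
  have [dx _] := is_diff_slice1 (dW (x, y) (conj U1x U2y)).
  have -> : grad (fun x' => f (x', y)) x =
      grad (fun x' => W (x', y)) x + grad F x.
    apply/rowP => i; rewrite !mxE /f /=.
    rewrite (@deriveD _ _ _ (fun x' => W (x', y)) F) //.
      exact: diff_derivable.
    by apply: diff_derivable; exact: dF.
  split=> [/eqP|->]; last by rewrite subrr.
  by rewrite addrC addr_eq0 => /eqP.
(* The generating function makes the base point of a preimage of [(y, eta)] critical, hence equal to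
   [xs y]. Conversely, [(xs y, grad F (xs y))] satisfies both equations with [eta = grad G y]. *)
have L2 : gamma @` grad_graph U1 F = grad_graph U2 G.
  have [[_ [gU2 _ _ _ _]] _] := gammaC.
  apply/seteqP; split=> [_ [[x xi] [U1x /= ->] <-]|[y eta] [U2y /= ->]].
    rewrite /cotangent /= in U1x.
    have U2y : U2 (gamma (x, grad F x)).1 by apply: gU2; exists (x, grad F x).
    case E : (gamma (x, grad F x)) U2y => [y eta] /= U2y.
    have [/(_ (esym E))[xiE etaE] _] := gammaW x (grad F x) y eta U1x U2y.
    have xE : x = xs y by apply: xs_uniq => //; apply/critE.
    by split=> //=; rewrite gradG // -xE.
  have U1x := xsU1 y U2y.
  exists (xs y, grad F (xs y)) => //.
  apply/esym/gammaW => //; split; last exact: gradG.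
  by apply/critE => //; exact: xs_crit.
have min y : U2 y -> is_minimum [set F x + W (x, y) | x in U1] (G y).
  move=> U2y; split; first by exists (xs y); [exact: xsU1|rewrite addrC].
  by move=> _ [x U1x <-]; rewrite [F x + _]addrC; exact: xs_min.
rewrite /= L2; split; last by exists G.
split; last by exists G.
exact: lagrangian_grad_graph.
Qed.
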